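(* For every integer $m\ge 1$, there is an integer $N(m)\ge 1$ such that for all $n\ge N(m)$ the following holds: if $G$ is any compact subgroup of $\mathrm{GL}_m(\mathbf{C})$, then every homomorphism $\rho: F_n\to G$ is redundant.
   Context: $F_n$ is the free group of rank $n$. A homomorphism $\rho:F_n\to G$ to a topological group $G$ is redundant if there is a free product decomposition $F_n=A\star B$, with $A$ and $B$ free groups of positive rank, such that $\rho(A)$ and $\rho(F_n)$ have the same closure in $G$. Here $G\subset\mathrm{GL}_m(\mathbf{C})$ carries its usual (Euclidean) topology. *)

(* Defs.v *)
From HB Require Import structures.
From mathcomp Require Import all_boot all_order all_algebra.
From mathcomp Require Import all_classical all_reals all_analysis.
From mathcomp Require Import complex.

Set Implicit Arguments.
Unset Strict Implicit.
Unset Printing Implicit Defensive.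

Import GRing.Theory Num.Theory.
Import numFieldNormedType.Exports.

Local Open Scope classical_set_scope.
Local Open Scope group_scope.

Section FreeGroup.
Variable X : choiceType.

(* The letter (x, false) is the generator x and (x, true) is its inverse. *)
Definition letter := (X * bool)%type.

Definition letter_inv (l : letter) : letter := (l.1, ~~ l.2).

Definition reduced (w : seq letter) : bool :=
  sorted (fun l l' => l' != letter_inv l) w.

Record free_group := FreeGroup { fg_word :> seq letter; _ : reduced fg_word }.

HB.instance Definition _ := [isSub for fg_word].
HB.instance Definition _ := [Choice of free_group by <:].

(* The reduced form of l :: w, for w reduced. *)
Definition push (l : letter) (w : seq letter) : seq letter :=
  if w is l' :: w' then if l' == letter_inv l then w' else l :: w
  else [:: l].

Lemma letter_invK : involutive letter_inv.
Proof. by case=> x b; rewrite /letter_inv /= negbK. Qed.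

Lemma reduced_push l w : reduced w -> reduced (push l w).
Proof.
case: w => [//|l' w] /=; case: eqP => [_ /path_sorted //|/eqP h].
by rewrite /reduced /= h.
Qed.

Lemma pushK l w : reduced w -> push (letter_inv l) (push l w) = w.
Proof.
case: w => [|l' w] /=; first by rewrite letter_invK eqxx.
case: (eqVneq l' (letter_inv l)) => [->|_ _] /=; last first.
  by rewrite letter_invK eqxx.
by case: w => [//|l'' w] /= /andP[/negPf ->].
Qed.

Lemma reduced_foldr u w : reduced w -> reduced (foldr push w u).
Proof. by move=> w_red; elim: u => //= l u; apply: reduced_push. Qed.

Lemma foldr_push_reduced u : reduced u -> foldr push [::] u = u.
Proof.
elim: u => //= l u IHu ru; rewrite IHu; last exact: path_sorted ru.
by case: u ru {IHu} => //= l' u /andP[/negPf ->].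
Qed.

Lemma foldr_push_push l u w : reduced w -> reduced u ->
  foldr push w (push l u) = push l (foldr push w u).
Proof.
move=> rw; case: u => //= l' u; case: eqP => //= -> ru.
by rewrite -{1}(letter_invK l) pushK // reduced_foldr.
Qed.

Lemma foldr_push_foldr u v w : reduced v -> reduced w ->
  foldr push w (foldr push v u) = foldr push (foldr push w v) u.
Proof.
move=> rv rw; elim: u => //= l u IHu.
by rewrite foldr_push_push ?IHu // reduced_foldr.
Qed.

Definition winv (w : seq letter) : seq letter := rev (map letter_inv w).

Lemma foldr_pushKV u w : reduced w ->
  foldr push (foldr push w u) (winv u) = w.
Proof.
move=> rw; elim: u => //= l u IHu.
by rewrite /winv /= rev_cons foldr_rcons pushK ?IHu // reduced_foldr.
Qed.

Lemma winvK : involutive winv.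
Proof. by move=> w; rewrite /winv map_rev revK mapK //; apply: letter_invK. Qed.

Definition fg_one : free_group := @FreeGroup [::] isT.

Lemma fg_mul_subproof (u v : free_group) : reduced (foldr push v u).
Proof. exact/reduced_foldr/(valP v). Qed.
Definition fg_mul (u v : free_group) : free_group :=
  FreeGroup (fg_mul_subproof u v).

Lemma fg_inv_subproof (u : free_group) : reduced (foldr push [::] (winv u)).
Proof. exact: reduced_foldr. Qed.
(* winv u is already reduced; folding push over it only makes this evident. *)
Definition fg_inv (u : free_group) : free_group :=
  FreeGroup (fg_inv_subproof u).

Lemma fg_mulA : associative fg_mul.
Proof.
by move=> u v w; apply/val_inj => /=; rewrite foldr_push_foldr // ?(valP v) ?(valP w).
Qed.

Lemma fg_mul1 : left_id fg_one fg_mul.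
Proof. by move=> u; apply/val_inj. Qed.

Lemma fg_mulr1 : right_id fg_one fg_mul.
Proof. by move=> u; apply/val_inj/foldr_push_reduced/(valP u). Qed.

Lemma fg_mulV : left_inverse fg_one fg_inv fg_mul.
Proof.
move=> u; apply/val_inj => /=; rewrite foldr_push_foldr ?(valP u) //.
by rewrite -[RHS](@foldr_pushKV u [::]) // (foldr_push_reduced (valP u)).
Qed.

Lemma fg_mulrV : right_inverse fg_one fg_inv fg_mul.
Proof.
move=> u; apply/val_inj => /=.
by rewrite -[RHS](@foldr_pushKV (winv u) [::]) // winvK.
Qed.

HB.instance Definition _ :=
  isGroup.Build free_group fg_mulA fg_mul1 fg_mulr1 fg_mulV fg_mulrV.

End FreeGroup.

Notation "''Free_' n" := (free_group 'I_n)
  (at level 8, n at level 2, format "''Free_' n").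

Definition is_subgroup (F : groupType) (A : set F) : Prop :=
  [/\ A 1, forall x y, A x -> A y -> A (x * y) & forall x, A x -> A x^-1].

Definition free_of_rank (F : groupType) (A : set F) (r : nat) : Prop :=
  exists2 phi : {multiplicative 'Free_r -> F}, injective phi & range phi = A.

(* F is the internal free product of A and B: the inclusions of A and B make F
   their coproduct. Only the restrictions of f to A and of g to B matter. *)
Definition is_free_product (F : groupType) (A B : set F) : Prop :=
  [/\ is_subgroup A, is_subgroup B &
      forall (H : groupType) (f g : F -> H),
        {in A &, {morph f : x y / x * y}} ->
        {in B &, {morph g : x y / x * y}} ->
        let extends (h : {multiplicative F -> H}) :=
          {in A, h =1 f} /\ {in B, h =1 g} in
        (exists h, extends h) /\
        (forall h h', extends h -> extends h' -> h =1 h')].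

(* rho is regarded as a homomorphism into the subgroup G of T, endowed with the
   induced topology: the closure in G of X `<=` G is G `&` closure X. *)
Definition redundant (F : groupType) (T : topologicalType) (G : set T)
    (rho : F -> T) : Prop :=
  exists A B : set F,
    [/\ is_free_product A B,
        exists2 r, (0 < r)%N & free_of_rank A r,
        exists2 s, (0 < s)%N & free_of_rank B s &
        G `&` closure (rho @` A) = G `&` closure (range rho)].

(* Seen as a numClosedFieldType, R[i] carries the norm topology of the generic
   instances of normedtype; 'M[Cplx R]_m then carries the product topology. *)
Definition Cplx (R : realType) : numClosedFieldType := R[i]%C.

Section GL.
Variables (R : realType) (m : nat).

Record GL := MkGL { GL_mx :> 'M[Cplx R]_m; _ : GL_mx \in unitmx }.

HB.instance Definition _ := [isSub for GL_mx].
HB.instance Definition _ := [Choice of GL by <:].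

Definition GL_one : GL := MkGL (unitmx1 _ m).

Lemma GL_mul_subproof (A B : GL) : (A *m B)%R \in unitmx.
Proof. by rewrite unitmx_mul (valP A) (valP B). Qed.
Definition GL_mul (A B : GL) : GL := MkGL (GL_mul_subproof A B).

Lemma GL_inv_subproof (A : GL) : invmx A \in unitmx.
Proof. by rewrite unitmx_inv (valP A). Qed.
Definition GL_inv (A : GL) : GL := MkGL (GL_inv_subproof A).

Lemma GL_mulA : associative GL_mul.
Proof. by move=> A B C; apply/val_inj/mulmxA. Qed.

Lemma GL_mul1 : left_id GL_one GL_mul.
Proof. by move=> A; apply/val_inj/mul1mx. Qed.

Lemma GL_mulr1 : right_id GL_one GL_mul.
Proof. by move=> A; apply/val_inj/mulmx1. Qed.

Lemma GL_mulV : left_inverse GL_one GL_inv GL_mul.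
Proof. by move=> A; apply/val_inj/mulVmx/(valP A). Qed.

Lemma GL_mulrV : right_inverse GL_one GL_inv GL_mul.
Proof. by move=> A; apply/val_inj/mulmxV/(valP A). Qed.

HB.instance Definition _ :=
  isGroup.Build GL GL_mulA GL_mul1 GL_mulr1 GL_mulV GL_mulrV.

HB.instance Definition _ := Topological.copy GL (initial_topology GL_mx).

End GL.

(* Main.v *)
Require Import Defs.
From HB Require Import structures.
From mathcomp Require Import all_boot all_order all_algebra.
From mathcomp Require Import all_classical all_reals all_analysis.
From mathcomp Require Import perm complex ring lra zify.
Local Open Scope classical_set_scope.

(** By compactness the image of [rho] is bounded. Write [f] for [rho] followed
    by the inclusion of [GL_m] of the complex numbers in the real matrices of
    size [k = 2 m]. The supremum over all [u] and [v] of the norms of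
    [f u *m x *m f v] is a norm [p] of [x] that multiplication by the image of
    [f] preserves ([inv_norm]); it takes the place of an invariant Hermitian
    form. The distance between [f u] and [f v] is then the distance from the
    identity to the image of [v^-1 * u].

    Both halves of the argument rest on one pigeonhole principle ([packing]):
    there is a number [c], depending only on [k] and not on [p], such that
    among [c] vectors in the unit ball of [p] two are at distance less than
    [1 / 2].

    First half, a Nielsen reduction ([short_generator]). Given [c] elements of
    a basis of the free group, all of whose images are at distance at least
    [eta] from the identity, two of the vectors [f b - 1] point in nearly the
    same direction. Dividing the longer element by the other one is a Nielsen
    move that shortens it by at least [eta / 2]. After finitely many such
    moves some image is within [eta] of the identity.

    Second half, a bound on how often a group can grow ([new_tangent]). Let
    [A] be contained in [A'], and suppose that [A'] has elements with images
    arbitrarily close to the identity but not in the closure of the image of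
    [A]. Translate them by almost closest elements of [A] and rescale their
    displacements from the identity: in the limit this gives a unit vector
    tangent to [A'] at distance at least [1] from all the vectors tangent to
    [A]. In a chain of groups this can happen fewer than [c] times, since the
    unit vectors so obtained are at mutual distances at least [1]. In terms of
    Lie groups, the dimension of the closure cannot grow indefinitely.

    Now cut a basis with at least [c * c] elements into blocks of [c] and let
    the groups grow block by block. At some block the second phenomenon does
    not occur: the new elements close to the identity lie in the closure of
    the image of the preceding group. The reduction of this block produces a
    basis vector [b_j] of this kind ([adherent_basis_vector]). The subgroup
    generated by the other basis vectors has then the same closure as the
    whole group, and it is a free factor whose complement is generated by
    [b_j]. *)

Set Implicit Arguments.
Unset Strict Implicit.
Unset Printing Implicit Defensive.

Import Order.TTheory GRing.Theory Num.Theory.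
Import numFieldNormedType.Exports.

(** * Bases of free groups *)

Section FreeGroupBases.
Local Open Scope group_scope.

Inductive gen (F : groupType) (S : set F) : set F :=
| gen_in x of S x : gen S x
| gen_one : gen S 1
| gen_mul x y of gen S x & gen S y : gen S (x * y)
| gen_inv x of gen S x : gen S x^-1.

Lemma gen_subgroup (F : groupType) (S : set F) : is_subgroup (gen S).
Proof. by split; [exact: gen_one | exact: gen_mul | exact: gen_inv]. Qed.

Lemma gen_sub (F : groupType) (S T : set F) : S `<=` gen T -> gen S `<=` gen T.
Proof.
move=> ST x; elim=> {x}[x /ST //||x y _ ? _ ?|x _ ?].
- exact: gen_one.
- exact: gen_mul.
- exact: gen_inv.
Qed.

(** Stated for plain functions that are multiplicative on the generated
    subgroup only, because the universal property of a free product takes its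
    data in that form. *)
Lemma gen_eq (F H : groupType) (S : set F) (f g : F -> H) :
    {in gen S &, {morph f : x y / x * y}} ->
    {in gen S &, {morph g : x y / x * y}} ->
  (forall x, S x -> f x = g x) -> forall x, gen S x -> f x = g x.
Proof.
move=> fM gM fgS.
have one (h : F -> H) : {in gen S &, {morph h : x y / x * y}} -> h 1 = 1.
  move=> hM; apply: (@mulgI _ (h 1)).
  by rewrite -hM ?mulg1 // inE; exact: gen_one.
have inv (h : F -> H) x : {in gen S &, {morph h : x y / x * y}} ->
    gen S x -> h x^-1 = (h x)^-1.
  move=> hM Sx; apply: (@mulgI _ (h x)).
  by rewrite -hM ?mulgV ?one // inE //; exact: gen_inv.
move=> x; elim=> {x}[x /fgS //||x y Sx IHx Sy IHy|x Sx IHx].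
- by rewrite !one.
- by rewrite fM ?gM ?inE // IHx IHy.
- by rewrite !inv // IHx.
Qed.

Lemma hom1 (F H : groupType) (f : {multiplicative F -> H}) : f 1 = 1.
Proof. by apply: (@mulgI _ (f 1)); rewrite -gmulfM !mulg1. Qed.

Lemma homV (F H : groupType) (f : {multiplicative F -> H}) x :
  f x^-1 = (f x)^-1.
Proof. by apply: (@mulgI _ (f x)); rewrite -gmulfM !mulgV hom1. Qed.

Lemma gen_hom_eq (F H : groupType) (S : set F) (f g : {multiplicative F -> H}) :
  (forall x, S x -> f x = g x) -> forall x, gen S x -> f x = g x.
Proof. by apply: gen_eq => x y _ _; rewrite gmulfM. Qed.

Section StandardBasis.
Variables (X : choiceType).

Definition fg_gen (x : X) : free_group X := @FreeGroup X [:: (x, false)] isT.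

Variables (H : groupType) (h : X -> H).

Definition letter_eval (l : letter X) : H := if l.2 then (h l.1)^-1 else h l.1.

Definition word_eval (w : seq (letter X)) : H :=
  foldr (fun l y => letter_eval l * y) 1 w.

Lemma letter_eval_inv l : letter_eval (letter_inv l) = (letter_eval l)^-1.
Proof. by case: l => x []; rewrite /letter_eval //= invgK. Qed.

(** Evaluation does not see the cancellation of a letter, so it is
    multiplicative although the product reduces words. *)
Lemma word_eval_push l w : word_eval (push l w) = letter_eval l * word_eval w.
Proof.
case: w => [//|l' w] /=; case: eqP => // ->.
by rewrite letter_eval_inv mulVKg.
Qed.

Lemma word_eval_foldr u v :
  word_eval (foldr (@push X) v u) = word_eval u * word_eval v.
Proof.
elim: u => [|l u IHu] /=; first by rewrite mul1g.
by rewrite word_eval_push IHu mulgA.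
Qed.

Definition fg_lift (u : free_group X) : H := word_eval u.

Lemma fg_lift_morph : {morph fg_lift : u v / u * v}.
Proof. by move=> u v; apply: word_eval_foldr. Qed.

End StandardBasis.

HB.instance Definition _ (X : choiceType) (H : groupType) (h : X -> H) :=
  isMultiplicative.Build (free_group X) H (fg_lift h) (fg_lift_morph h).

Lemma fg_lift_gen (X : choiceType) (H : groupType) (h : X -> H) x :
  fg_lift h (fg_gen x) = h x.
Proof. by rewrite /fg_lift /= mulg1. Qed.

Lemma fg_gen_generates (X : choiceType) (u : free_group X) :
  gen (range (@fg_gen X)) u.
Proof.
case: u => w; elim: w => [|l w IHw] w_red.
  by rewrite (_ : FreeGroup w_red = 1); [exact: gen_one | exact: val_inj].
have w'_red : reduced w by exact: path_sorted w_red.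
pose g := if l.2 then (fg_gen l.1)^-1 else fg_gen l.1.
have -> : FreeGroup w_red = g * FreeGroup w'_red.
  apply: val_inj; rewrite -[LHS](foldr_push_reduced w_red) /= -[LHS]/(push l _).
  rewrite (foldr_push_reduced w'_red) /g.
  by case: (l) => x [].
apply: gen_mul (IHw _).
by rewrite /g; case: ifP => _; do ?apply: gen_inv; apply: gen_in; exists l.1.
Qed.

(** Free bases are encoded by generation together with extension of maps,
    rather than by an isomorphism with a free group: with this form neither a
    change of basis nor a splitting of the basis requires words. *)
Definition is_basis (F : groupType) (I : Type) (b : I -> F) : Prop :=
  (forall x, gen (range b) x) /\
  (forall (H : groupType) (h : I -> H),
     exists f : {multiplicative F -> H}, forall i, f (b i) = h i).

Lemma fg_gen_basis (X : choiceType) : is_basis (@fg_gen X).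
Proof.
split; first exact: fg_gen_generates.
by move=> H h; exists (fg_lift h) => x; apply: fg_lift_gen.
Qed.

Lemma basis_free_product (F : groupType) (I : eqType) (b : I -> F) (j : I) :
  is_basis b ->
  is_free_product (gen (b @` [set i | i != j])) (gen [set b j]).
Proof.
move=> [bgen bext]; split; [exact: gen_subgroup | exact: gen_subgroup |].
move=> H f g fM gM extends; split.
  have [h hb] := bext H (fun i => if i == j then g (b j) else f (b i)).
  exists h; split=> x; rewrite inE.
    apply: gen_eq => //; first by move=> ? ? _ _; rewrite gmulfM.
    by move=> _ [i /= /negPf ij <-]; rewrite hb ij.
  apply: gen_eq => //; first by move=> ? ? _ _; rewrite gmulfM.
  by move=> _ ->; rewrite hb eqxx.
move=> h h' [hA hB] [hA' hB'] x.
apply: gen_hom_eq (bgen x) => _ [i _ <-].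
have [->|ij] := eqVneq i j.
  by rewrite hB ?hB' // inE; apply: gen_in.
by rewrite hA ?hA' // inE; apply: gen_in; exists i.
Qed.

(** Injectivity comes from the retraction that kills the basis vectors outside
    the image of [e]. *)
Lemma basis_free_of_rank (F : groupType) (I : eqType) (b : I -> F) r
    (e : 'I_r -> I) :
  is_basis b -> injective e -> free_of_rank (gen (range (b \o e))) r.
Proof.
move=> [bgen bext] einj.
have [f fb] := (fg_gen_basis 'I_r).2 F (b \o e).
exists f.
  pose back i := if [pick k | e k == i] is Some k then fg_gen k else 1.
  have [g gb] := bext _ back.
  apply: (can_inj (g := g)) => u.
  apply: (gen_hom_eq (f := g \o f) (g := idfun) _ (fg_gen_generates u)).
  move=> _ [k _ <-] /=; rewrite fb gb /back.
  by case: pickP => [k' /eqP/einj->|/(_ k)]; rewrite ?eqxx.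
apply/seteqP; split=> [_ [u _ <-]|x].
  elim: (fg_gen_generates u) => {u}[_ [k _ <-]||u v _ ? _ ?|u _ ?].
  - by rewrite fb; apply: gen_in; exists k.
  - by rewrite hom1; apply: gen_one.
  - by rewrite gmulfM; apply: gen_mul.
  - by rewrite homV; apply: gen_inv.
elim=> {x}[_ [k _ <-]||_ _ _ [u _ <-] _ [v _ <-]|_ _ [u _ <-]].
- by exists (fg_gen k); rewrite ?fb.
- by exists 1; rewrite ?hom1.
- by exists (u * v); rewrite ?gmulfM.
- by exists u^-1; rewrite ?homV.
Qed.

(** The only change of basis in the proof; the division is on the left to fit
    [inv_norm_dist]. *)
Definition nielsen (F : groupType) (I : eqType) (b : I -> F) (i j l : I) : F :=
  if l == j then (b i)^-1 * b j else b l.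

Lemma nielsen_basis (F : groupType) (I : eqType) (b : I -> F) (i j : I) :
  i != j -> is_basis b -> is_basis (nielsen b i j).
Proof.
move=> /negPf ij [bgen bext].
have ni l : l != j -> gen (range (nielsen b i j)) (b l).
  by move=> /negPf lj; apply: gen_in; exists l; rewrite // /nielsen lj.
split=> [x|H h].
  apply: gen_sub (bgen x) => _ [l _ <-].
  have [->|/ni//] := eqVneq l j.
  rewrite -(mulVKg (b i) (b j)); apply: gen_mul; first by apply: ni; rewrite ij.
  by apply: gen_in; exists j; rewrite // /nielsen eqxx.
have [f fb] := bext H (fun l => if l == j then h i * h j else h l).
exists f => l; rewrite /nielsen; case: eqP => [->|/eqP/negPf lj].
  by rewrite gmulfM homV !fb ij eqxx mulKg.
by rewrite fb lj.
Qed.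

End FreeGroupBases.

Local Open Scope ring_scope.

(** * Norms on a real vector space and packing *)

Section Packing.
Variables (R : realType) (D : nat).

(** A norm on the space of row vectors, normalised so as to dominate the
    coordinates; a comparison in the other direction is automatic. *)
Record coord_norm (p : 'rV[R]_D -> R) : Prop := CoordNorm {
  cnormD : forall x y : 'rV[R]_D, p (x + y) <= p x + p y;
  cnormZ : forall a (x : 'rV[R]_D), p (a *: x) = `|a| * p x;
  cnorm_coord : forall (x : 'rV[R]_D) j, `|x 0 j| <= p x }.

Variables (p : 'rV[R]_D -> R) (pN : coord_norm p).

Lemma cnorm0 : p 0 = 0.
Proof. by rewrite -(scale0r 0) (cnormZ pN) normr0 mul0r. Qed.

Lemma cnormN x : p (- x) = p x.
Proof. by rewrite -scaleN1r (cnormZ pN) normrN1 mul1r. Qed.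

Lemma cnorm_ge0 x : 0 <= p x.
Proof. have := cnormD pN x (- x); rewrite cnormN subrr cnorm0; lra. Qed.

Lemma cnorm_sum I (r : seq I) (F : I -> 'rV[R]_D) :
  p (\sum_(i <- r) F i) <= \sum_(i <- r) p (F i).
Proof.
elim/big_ind2: _ => [|x a y b xa yb|//]; first by rewrite cnorm0.
exact: le_trans (cnormD pN _ _) (lerD xa yb).
Qed.

Let dets : set R := [set t | exists2 E : 'M[R]_D,
  forall i, p (row i E) <= 1 & t = `|\det E|].

Lemma det_unit_rows_le (E : 'M[R]_D) :
  (forall i, p (row i E) <= 1) -> `|\det E| <= (D`!)%:R.
Proof.
move=> Erow; rewrite /determinant (le_trans (ler_norm_sum _ _ _)) //.
rewrite -[D`!]card_Sn -sum1_card natr_sum.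
rewrite [leRHS](eq_bigl xpredT) => [|s]; last by rewrite inE.
apply: ler_sum => s _; rewrite normrM normr_sign mul1r normr_prod.
apply: prodr_ile1 => i _; rewrite normr_ge0 /=.
apply: le_trans (Erow i).
by have := cnorm_coord pN (row i E) (s i); rewrite mxE.
Qed.

Lemma dets_has_sup : has_sup dets /\ 0 < sup dets.
Proof.
pose C := 1 + \sum_i p (delta_mx 0 i).
have C_gt0 : 0 < C by rewrite ltr_wpDr ?sumr_ge0 // => *; apply: cnorm_ge0.
have C_in : dets `|\det (C^-1%:M : 'M[R]_D)|.
  exists (C^-1%:M) => // i; rewrite -scalemx1 linearZ /= row1 (cnormZ pN).
  rewrite gtr0_norm ?invr_gt0 // mulrC ler_pdivrMr // mul1r /C (bigD1 i) //=.
  by rewrite addrCA lerDl addr_ge0 ?sumr_ge0 // => *; apply: cnorm_ge0.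
have dets_ub : has_ubound dets.
  by exists (D`!)%:R => _ [E /det_unit_rows_le ? ->].
split; first by split => //; eexists; exact: C_in.
apply: lt_le_trans (ub_le_sup dets_ub C_in).
by rewrite det_scalar normr_gt0 expf_neq0 // invr_eq0 gt_eqF.
Qed.

(** Among the matrices whose rows lie in the unit ball take one whose
    determinant has absolute value at least half of the supremum. By Cramer's
    rule a coordinate of a vector [x] in the basis of its rows is the ratio of
    two such determinants, one of them with a row replaced by [x]; if [x] is
    in the unit ball, the ratio is at most [2]. A matrix attaining the
    supremum would give Auerbach's bound [1]; with the factor [2] the
    existence of the supremum is enough. *)
Lemma near_auerbach_basis : exists E : 'M[R]_D,
  [/\ E \in unitmx, forall i, p (row i E) <= 1 &
      forall x, p x <= 1 -> forall j, `|(x *m invmx E) 0 j| <= 2].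
Proof.
have [dets_sup s_gt0] := dets_has_sup.
have hs : 0 < sup dets / 2 by lra.
have [t [E Erow ->] Emax] := sup_adherent hs dets_sup.
have Edet : 0 < `|\det E| by lra.
have Eunit : E \in unitmx by rewrite unitmxE unitfE -normr_gt0.
exists E; split=> // x px j.
pose E' := \matrix_i (if i == j then x else row i E).
have E'row i : p (row i E') <= 1 by rewrite rowK; case: ifP.
have -> : (x *m invmx E) 0 j = \det E' / \det E.
  rewrite /invmx Eunit -scalemxAr mxE mulrC; congr (_ / _).
  rewrite mxE (expand_det_row _ j); apply: eq_bigr => k _.
  rewrite [E' _ _]mxE eqxx mxE; congr (_ * _).
  rewrite /cofactor; congr (_ * \det _); apply/matrixP=> a b.
  by rewrite !mxE eq_sym (negPf (neq_lift _ _)) mxE.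
rewrite normf_div ler_pdivrMr //.
have := ub_le_sup dets_sup.2 (ex_intro2 _ _ E' E'row erefl); lra.
Qed.

End Packing.

(** The number of boxes in a grid of mesh [1 / (2 D + 1)] on the cube
    [[-2, 2]^D], plus one. *)
Definition packing_number D : nat :=
  #|{ffun 'I_D -> 'I_(4 * D.*2.+1).+1}|.+1.

(** In the coordinates of [near_auerbach_basis] the unit ball of [p] lies in
    the cube [[-2, 2]^D], whatever [p] is. Two of the vectors fall in the same
    box of the grid, and since the basis vectors have norm at most [1] their
    distance is at most [D / (2 D + 1)]. What matters is that the bound
    depends on the dimension only and not on the norm. *)
Lemma packing (R : realType) D (p : 'rV[R]_D -> R)
    (x : 'I_(packing_number D) -> 'rV[R]_D) :
  coord_norm p -> (forall i, p (x i) <= 1) ->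
  exists i j, i != j /\ p (x i - x j) < 1 / 2.
Proof.
move=> pN x_le1; have [E [Eunit Erow Ecoord]] := near_auerbach_basis pN.
pose M := D.*2.+1.
have M_gt0 : 0 < M%:R :> R by rewrite ltr0n.
pose y i := x i *m invmx E.
pose t i k : R := (y i 0 k + 2) * M%:R.
have t_itv i k : 0 <= t i k <= (4 * M)%:R.
  have := Ecoord _ (x_le1 i) k; rewrite ler_norml -/(y i) => /andP[y_ge y_le].
  rewrite mulr_ge0 ?natrM /t ?ler_wpM2r ?ler0n //; lra.
pose bin i := [ffun k => inord (Num.trunc (t i k)) : 'I_(4 * M).+1].
have /injectivePn[i [j ij bin_ij]] : ~~ injectiveb bin.
  by apply/injectiveP => /leq_card; rewrite card_ord ltnn.
exists i, j; split=> //.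
have trunc_ij k : Num.trunc (t i k) = Num.trunc (t j k).
  have := congr1 (fun f : {ffun _ -> _} => val (f k)) bin_ij.
  have le l : (Num.trunc (t l k) < (4 * M).+1)%N.
    rewrite ltnS -(ler_nat R); have /andP[t_ge0] := t_itv l k.
    by apply: le_trans; rewrite truncn_le.
  by rewrite /= !ffunE !inordK.
have y_ij k : `|y i 0 k - y j 0 k| <= M%:R^-1.
  have : `|t i k - t j k| <= 1.
    have /andP[ti _] := t_itv i k; have /andP[tj _] := t_itv j k.
    have := truncnS_gt (t i k); have := truncnS_gt (t j k).
    move: ti tj; rewrite -!truncn_le trunc_ij -natr1 ler_norml.
    by move=> *; apply/andP; split; lra.
  rewrite /t -mulrBl opprD addrACA subrr addr0 normrM (gtr0_norm M_gt0).
  by rewrite -ler_pdivlMr // div1r.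
have -> : x i - x j = \sum_k (y i 0 k - y j 0 k) *: row k E.
  transitivity ((y i - y j) *m E); first by rewrite mulmxBl !mulmxKV.
  by rewrite mulmx_sum_row; apply: eq_bigr => k _; rewrite !mxE.
apply: (le_lt_trans (cnorm_sum pN _ _)).
apply: (@le_lt_trans _ _ (\sum_(k < D) M%:R^-1)).
  apply: ler_sum => k _; rewrite (cnormZ pN).
  apply: le_trans (y_ij k); rewrite ler_piMr //.
have M_D : M%:R = 2 * D%:R + 1 :> R by rewrite /M -addn1 -mul2n natrD natrM.
by rewrite sumr_const card_ord -[_ *+ D]mulr_natl ltr_pdivrMr // M_D; lra.
Qed.

Section CoordNormTheory.
Variables (R : realType) (D : nat) (p : 'rV[R]_D -> R) (pN : coord_norm p).

(** Bolzano-Weierstrass for an arbitrary norm. *)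
Lemma cnorm_cluster (x : nat -> 'rV[R]_D) : (forall n, p (x n) <= 1) ->
  exists2 y, p y <= 1 &
    forall eps N, 0 < eps -> exists2 n, (N <= n)%N & p (x n - y) < eps.
Proof.
move=> x_le1.
have box := @rV_compact R D (fun _ => [set` `[-1, 1]])
  (fun _ => @segment_compact R _ _).
have [|y [_ y_cluster]] := box (x @ \oo) _.
  exists 0 => // n _ i /=; rewrite in_itv /= -ler_norml.
  exact: le_trans (cnorm_coord pN (x n) i) (x_le1 n).
have y_lim eps N : 0 < eps -> exists2 n, (N <= n)%N & p (x n - y) < eps.
  move=> eps_gt0; pose C := 1 + \sum_i p (delta_mx 0 i).
  have C_gt0 : 0 < C.
    by rewrite ltr_wpDr ?sumr_ge0 // => *; apply: cnorm_ge0 pN _.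
  have tail : (x @ \oo) (x @` [set n | (N <= n)%N]).
    by exists N => // n Nn; exists n.
  have near_y := nbhsx_ballx y (eps / C) (divr_gt0 eps_gt0 C_gt0).
  have [_ [[n /= Nn <-] xn_y]] := y_cluster _ _ tail near_y.
  exists n => //; rewrite [_ - y]row_sum_delta.
  apply: le_lt_trans (cnorm_sum pN _ _) _.
  apply: (@le_lt_trans _ _ (\sum_i eps / C * p (delta_mx 0 i))).
    apply: ler_sum => i _; rewrite (cnormZ pN) ler_wpM2r ?(cnorm_ge0 pN) //.
    by move: xn_y => [_ /(_ 0 i)]; rewrite /ball /= !mxE distrC => /ltW.
  rewrite -mulr_sumr mulrAC ltr_pdivrMr // ltr_pM2l // /C; lra.
exists y => //; rewrite leNgt; apply/negP => py_gt1.
have [n _] : exists2 n, (0 <= n)%N & p (x n - y) < p y - 1.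
  by apply: y_lim; rewrite subr_gt0.
have := cnormD pN (x n) (y - x n).
rewrite addrCA subrr addr0 -(opprB y) (cnormN pN).
have := x_le1 n; lra.
Qed.

End CoordNormTheory.

(** * The supremum norm of matrices *)

Section MatrixNorm.
Variable R : realType.

Lemma mx_norm_coord m n (x : 'M[R]_(m, n)) i j : `|x i j| <= `|x|.
Proof.
rewrite /Num.norm /= mx_normrE.
exact: (le_bigmax _ (fun ij => `|x ij.1 ij.2|) (i, j)).
Qed.

Lemma mx_norm_le m n (x : 'M[R]_(m, n)) c :
  0 <= c -> (forall i j, `|x i j| <= c) -> `|x| <= c.
Proof.
by move=> c0 xc; rewrite /Num.norm /= mx_normrE; apply/bigmax_leP; split.
Qed.

Lemma mx_normM k (x y : 'M[R]_k) : `|x *m y| <= k%:R * (`|x| * `|y|).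
Proof.
apply: mx_norm_le => [|i j]; first by rewrite !mulr_ge0 ?ler0n.
rewrite mxE (le_trans (ler_norm_sum _ _ _)) //.
apply: le_trans (_ : \sum_(l < k) `|x| * `|y| <= _).
  by apply: ler_sum => l _; rewrite normrM ler_pM // mx_norm_coord.
by rewrite sumr_const card_ord mulr_natl.
Qed.

End MatrixNorm.

(** * The bi-invariant norm of a bounded representation *)

Section BoundedRepresentation.
Variables (R : realType) (k : nat) (F : groupType) (f : F -> 'M[R]_k) (B : R).
Hypotheses (fM : forall u v, f (u * v)%g = f u *m f v) (f1 : f 1%g = 1%:M).
Hypothesis fB : forall u, `|f u| <= B.

(** For a bounded image this is a norm, and multiplication by the image on
    either side preserves it: it plays the part of an invariant Hermitian
    structure. *)
Definition inv_norm (x : 'M[R]_k) : R :=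
  sup (range (fun uv => `|f uv.1 *m x *m f uv.2|)).

Local Notation p := inv_norm.

Lemma inv_norm_ge x u v : `|f u *m x *m f v| <= p x.
Proof.
apply: ub_le_sup; last by exists (u, v).
exists (k%:R * (k%:R * (B * `|x|) * B)) => _ [[a b] _ <-] /=.
have B_ge0 : 0 <= B := le_trans (normr_ge0 _) (fB 1%g).
apply: le_trans (mx_normM _ _) _; apply: ler_wpM2l; first exact: ler0n.
apply: ler_pM => //; apply: le_trans (mx_normM _ _) _.
by rewrite ler_wpM2l ?ler0n // ler_wpM2r.
Qed.

Lemma inv_norm_le x c : (forall u v, `|f u *m x *m f v| <= c) -> p x <= c.
Proof.
move=> xc; apply: ge_sup => [|_ [[u v] _ <-]]; last exact: xc.
by exists `|f 1%g *m x *m f 1%g|, (1, 1)%g.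
Qed.

Lemma inv_norm_ge_norm x : `|x| <= p x.
Proof. by have := inv_norm_ge x 1%g 1%g; rewrite f1 mul1mx mulmx1. Qed.

Lemma inv_norm_ge0 x : 0 <= p x.
Proof. exact: le_trans (inv_norm_ge_norm x). Qed.

Lemma inv_normD x y : p (x + y) <= p x + p y.
Proof.
apply: inv_norm_le => u v; rewrite mulmxDr mulmxDl.
by apply: le_trans (ler_normD _ _) _; apply: lerD; apply: inv_norm_ge.
Qed.

Lemma inv_normZ a x : p (a *: x) = `|a| * p x.
Proof.
have le b y : p (b *: y) <= `|b| * p y.
  apply: inv_norm_le => u v; rewrite -scalemxAr -scalemxAl normrZ.
  by rewrite ler_wpM2l // inv_norm_ge.
apply/eqP; rewrite eq_le le /=; have [->|a_neq0] := eqVneq a 0.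
  by rewrite normr0 mul0r inv_norm_ge0.
rewrite mulrC -ler_pdivlMr ?normr_gt0 // mulrC -normfV.
by apply: le_trans (le _ _); rewrite scalerK.
Qed.

Lemma inv_normN x : p (- x) = p x.
Proof. by rewrite -scaleN1r inv_normZ normrN1 mul1r. Qed.

Lemma inv_normB x y : p (x - y) = p (y - x).
Proof. by rewrite -inv_normN opprB. Qed.

Lemma inv_norm0 : p 0 = 0.
Proof. by rewrite -(scale0r 0) inv_normZ normr0 mul0r. Qed.

Lemma inv_norm_mull u x : p (f u *m x) = p x.
Proof.
have le w y : p (f w *m y) <= p y.
  by apply: inv_norm_le => a b; rewrite mulmxA -fM inv_norm_ge.
apply/eqP; rewrite eq_le le /=.
by apply: le_trans (le u^-1%g _); rewrite mulmxA -fM mulVg f1 mul1mx.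
Qed.

Lemma inv_norm_mulr u x : p (x *m f u) = p x.
Proof.
have le w y : p (y *m f w) <= p y.
  by apply: inv_norm_le => a b; rewrite mulmxA -mulmxA -fM inv_norm_ge.
apply/eqP; rewrite eq_le le /=.
by apply: le_trans (le u^-1%g _); rewrite -mulmxA -fM mulgV f1 mulmx1.
Qed.

Lemma inv_normM x y : p (x *m y) <= k%:R * (p x * p y).
Proof.
apply: inv_norm_le => u v; rewrite !mulmxA -(mulmxA (f u *m x)).
apply: le_trans (mx_normM _ _) _; rewrite ler_wpM2l ?ler0n //.
rewrite ler_pM //.
  by have := inv_norm_ge x u 1%g; rewrite f1 mulmx1.
by have := inv_norm_ge y 1%g v; rewrite f1 mul1mx.
Qed.

(** Gives access to the results on row vectors, of dimension [k * k]. *)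
Lemma inv_norm_coord_norm : coord_norm (p \o @vec_mx R k k).
Proof.
split=> [x y|a x|x j] /=.
- by rewrite linearD inv_normD.
- by rewrite linearZ inv_normZ.
apply: le_trans (inv_norm_ge_norm _).
case/mxvec_indexP: j => i j; have := mx_norm_coord (vec_mx x) i j.
by rewrite mxE.
Qed.

(** Left translation turns a distance into a distance to the identity. *)
Lemma inv_norm_dist u v : p (f u - f v) = p (f (v^-1 * u)%g - 1%:M).
Proof.
by rewrite -(inv_norm_mull v^-1%g) mulmxBr -!fM mulVg f1.
Qed.

End BoundedRepresentation.

(** * Directions of accumulation *)

Section Tangent.
Variables (R : realType) (k : nat) (F : groupType) (f : F -> 'M[R]_k) (B : R).
Hypotheses (fM : forall u v, f (u * v)%g = f u *m f v) (f1 : f 1%g = 1%:M).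
Hypothesis fB : forall u, `|f u| <= B.

Local Notation p := (inv_norm f).

Let pD := inv_normD fB.
Let pZ := inv_normZ f1 fB.
Let pN := inv_normN f1 fB.
Let p_ge0 := inv_norm_ge0 f1 fB.

(** When [A] is a group these are the vectors of the Lie algebra of the
    closure of its image. Asking for an approximation at every small scale
    [s], and not only along a sequence, is what makes two such vectors,
    possibly of two groups, comparable. *)
Definition tangent (A : set F) (X : 'M[R]_k) : Prop :=
  forall eps, 0 < eps -> exists2 s0, 0 < s0 & forall s, 0 < s < s0 ->
    exists2 u, A u & p (f u - 1%:M - s *: X) <= eps * s.

Definition adherent (A : set F) (x : F) : Prop :=
  forall eps, 0 < eps -> exists2 c, A c & p (f x - f c) < eps.

Lemma inv_norm_exp u n : p (f (u ^+ n)%g - 1%:M) <= n%:R * p (f u - 1%:M).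
Proof.
elim: n => [|n IHn]; first by rewrite f1 subrr (inv_norm0 f1 fB) mul0r.
have -> : f (u ^+ n.+1)%g - 1%:M =
    f (u ^+ n)%g *m (f u - 1%:M) + (f (u ^+ n)%g - 1%:M).
  by rewrite expgSr fM mulmxBr mulmx1 addrA subrK.
apply: le_trans (pD _ _) _; rewrite (inv_norm_mull fM f1 fB).
rewrite -natr1 mulrDl mul1r.
by rewrite addrC lerD2r.
Qed.

(** Powers of an element near the identity follow a line to second order. The
    estimate stands in for the exponential map. *)
Lemma inv_norm_exp_linear u n (v := f u - 1%:M) :
  p (f (u ^+ n)%g - 1%:M - n%:R *: v) <= k%:R * (n%:R * p v) ^+ 2.
Proof.
elim: n => [|n IHn].
  by rewrite f1 subrr scale0r subr0 (inv_norm0 f1 fB) !mulr_ge0 ?sqr_ge0.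
have -> : f (u ^+ n.+1)%g - 1%:M - n.+1%:R *: v =
    (f (u ^+ n)%g - 1%:M) *m v + (f (u ^+ n)%g - 1%:M - n%:R *: v).
  rewrite expgSr fM -natr1 scalerDl scale1r /v.
  rewrite !(mulmxBr, mulmxBl) !mulmx1 !mul1mx.
  by move: (_ *m _) => a; apply/matrixP => i j; rewrite !mxE; ring.
have prod_le : p ((f (u ^+ n)%g - 1%:M) *m v) <= k%:R * (n%:R * p v * p v).
  apply: le_trans (inv_normM f1 fB _ _) _.
  by rewrite ler_wpM2l // ler_wpM2r // inv_norm_exp.
apply: le_trans (pD _ _) _; apply: le_trans (lerD prod_le IHn) _.
rewrite -mulrDr ler_wpM2l // -natr1 -/v.
by have n_ge0 : 0 <= n%:R :> R by []; have := p_ge0 v; nra.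
Qed.

Variables (A A' : set F).
Hypotheses (Agrp : is_subgroup A) (A'grp : is_subgroup A') (AA' : A `<=` A').

(** Divide [x] by an element of [A] almost closest to it: for the quotient the
    identity is almost a closest point of [A]. *)
Lemma near_closest x th : 0 < th <= 1 -> A' x -> p (f x - 1%:M) < th / 2 ->
    ~ adherent A x ->
  exists u, [/\ A' u, 0 < p (f u - 1%:M) < th &
    forall c, A c -> (1 - th) * p (f u - 1%:M) <= p (f u - f c)].
Proof.
have [A1 AM AV] := Agrp; have [_ A'M _] := A'grp.
move=> /andP[th_gt0 th_le1] A'x x_near1 x_notin.
pose dists := [set p (f x - f c) | c in A].
have dists_lb : has_lbound dists by exists 0 => _ [c _ <-].
have dists_inf : has_inf dists by split => //; exists (p (f x - f 1%g)), 1%g.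
pose d := inf dists.
have d_le c : A c -> d <= p (f x - f c).
  by move=> Ac; apply: ge_inf => //; exists c.
have d_gt0 : 0 < d.
  rewrite ltNge; apply/negP => d_le0; apply: x_notin => eps eps_gt0.
  have [_ [c Ac <-] x_c] := inf_adherent eps_gt0 dists_inf.
  by exists c => //; apply: lt_le_trans x_c _; rewrite -/d gerDr.
have [_ [c Ac <-] x_c] := inf_adherent (mulr_gt0 d_gt0 th_gt0) dists_inf.
have d_x := d_le _ A1; rewrite f1 in d_x.
have u_1 : p (f (c^-1 * x)%g - 1%:M) = p (f x - f c).
  by rewrite [RHS](inv_norm_dist fM f1 fB).
(* [c] is within a factor [1 + th] of the infimum, and
   [(1 - th) * (1 + th) <= 1]. *)
exists (c^-1 * x)%g; split.
- by apply: A'M => //; apply/AA'/AV.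
- rewrite u_1; have := d_le _ Ac; rewrite -/d in x_c.
  move=> ?; apply/andP; split; nra.
- move=> c' Ac'; rewrite u_1.
  have -> : p (f (c^-1 * x)%g - f c') = p (f x - f (c * c')%g).
    by rewrite !(inv_norm_dist fM f1 fB) invgM mulgA.
  apply: le_trans (d_le _ (AM _ _ Ac Ac')).
  rewrite -/d in x_c; nra.
Qed.

Hypothesis new_near_one : forall eta, 0 < eta ->
  exists x, [/\ A' x, p (f x - 1%:M) < eta & ~ adherent A x].

(** Normalise the displacements from the identity of the elements given by
    [near_closest] and take a cluster point. *)
Lemma limit_direction : exists2 X, p X <= 1 & forall eps, 0 < eps ->
  exists u (v := f u - 1%:M), [/\ A' u, 0 < p v < eps,
    forall c, A c -> (1 - eps) * p v <= p (f u - f c) &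
    p ((p v)^-1 *: v - X) < eps].
Proof.
have th_gt0 n : 0 < n.+1%:R^-1 :> R by rewrite invr_gt0.
have seq n : exists u, [/\ A' u, 0 < p (f u - 1%:M) < n.+1%:R^-1 &
    forall c, A c -> (1 - n.+1%:R^-1) * p (f u - 1%:M) <= p (f u - f c)].
  have [x [A'x x_1 x_far]] := new_near_one (divr_gt0 (th_gt0 n) (ltr0n _ 2)).
  by apply: near_closest A'x x_1 x_far; rewrite th_gt0 invf_le1 ?ler1n.
have [u uP] := choice seq.
pose w n := (p (f (u n) - 1%:M))^-1 *: (f (u n) - 1%:M).
have w_1 n : p (w n) = 1.
  have [_ /andP[v_gt0 _] _] := uP n.
  by rewrite pZ gtr0_norm ?invr_gt0 // mulVf ?gt_eqF.
have [|y y_le1 y_lim] :=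
    cnorm_cluster (inv_norm_coord_norm f1 fB) (x := mxvec \o w).
  by move=> n /=; rewrite mxvecK w_1.
exists (vec_mx y) => // eps eps_gt0.
have [n n_ge w_y] := y_lim eps (Num.trunc eps^-1) eps_gt0.
have n_eps : n.+1%:R^-1 <= eps.
  rewrite invf_ple ?posrE //; apply: ltW; apply: lt_le_trans (truncnS_gt _) _.
  by rewrite ler_nat ltnS.
have [A'u /andP[u_gt0 u_lt] u_far] := uP n.
exists (u n); split => //.
- by rewrite u_gt0 (lt_le_trans u_lt).
- move=> c Ac; apply: le_trans (u_far c Ac).
  by rewrite ler_wpM2r // lerB.
- by move: w_y; rewrite /= linearB /= mxvecK.
Qed.

(** A direction [X] obtained from [limit_direction] is tangent to [A'], by
    taking powers. It is at distance at least [1] from every tangent vector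
    [Y] of [A]: at the scale of the displacement [v] of an element [u] whose
    almost closest point in [A] is the identity, some element of [A] is
    displaced by nearly [p v *: Y], and it cannot be much closer to [u] than
    the identity is. *)
Lemma new_tangent : exists X, [/\ p X <= 1, tangent A' X &
  forall Y, tangent A Y -> 1 <= p (X - Y)].
Proof.
have [_ A'M _] := A'grp; have [A'1 _ _] := A'grp.
have [X X_le1 XP] := limit_direction; exists X; split => //.
  move=> eps eps_gt0.
  have k_ge0 : 0 <= k%:R :> R by [].
  (* Below this scale the quadratic error of [inv_norm_exp_linear] is at most
     [eps / 2 * s]. *)
  exists (eps / (2 * (k%:R + 1))) => [|s /andP[s_gt0]].
    by rewrite divr_gt0 // mulr_gt0 // ltr_wpDl.
  rewrite ltr_pdivlMr => [s_lt|]; last by rewrite mulr_gt0 // ltr_wpDl.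
  have eta_gt0 : 0 < Num.min (eps / 4) (s * eps / 4).
    by rewrite lt_min !divr_gt0 ?mulr_gt0.
  have [u [A'u /andP[v_gt0 v_lt] _ w_X]] := XP _ eta_gt0.
  move: v_lt w_X; rewrite !lt_min => /andP[_ v_lt] /andP[w_X _].
  set v := f u - 1%:M in v_gt0 v_lt w_X *.
  pose n := Num.trunc (s / p v).
  have n_le : n%:R * p v <= s.
    by rewrite -ler_pdivlMr // truncn_le divr_ge0 // ltW.
  have n_gt : s < n%:R * p v + p v.
    by rewrite -[X in _ + X]mul1r -mulrDl natr1 -ltr_pdivrMr // truncnS_gt.
  exists (u ^+ n)%g.
    by elim: (n) => [|l IHl]; rewrite ?expg0 // expgS; apply: A'M.
  have -> : f (u ^+ n)%g - 1%:M - s *: X = (f (u ^+ n)%g - 1%:M - n%:R *: v) +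
      ((n%:R * p v) *: ((p v)^-1 *: v - X) + (n%:R * p v - s) *: X).
    rewrite [(_ * _) *: _]scalerBr scalerA mulfK ?gt_eqF // scalerBl.
    by rewrite [_ *: v - _ + (_ - _)]addrA subrK addrA subrK.
  apply: le_trans (pD _ _) _.
  apply: le_trans (lerD (inv_norm_exp_linear _ _) (pD _ _)) _.
  rewrite -/v !pZ ger0_norm; last by rewrite mulr_ge0 // ltW.
  rewrite ler0_norm; last by rewrite subr_le0.
  have np_ge0 : 0 <= n%:R * p v by rewrite mulr_ge0 // ltW.
  move: (n%:R * p v) n_le n_gt np_ge0 => t t_le t_gt t_ge0.
  have : k%:R * t ^+ 2 <= k%:R * s ^+ 2.
    by rewrite ler_wpM2l // ler_pXn2r ?nnegrE // ltW.
  have : t * p ((p v)^-1 *: v - X) <= s * (eps / 4).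
    by apply: ler_pM => //; apply: ltW.
  have : - (t - s) * p X <= (s * eps / 4) * 1.
    by apply: ler_pM => //; lra.
  have : k%:R * s ^+ 2 <= eps / 2 * s by nra.
  lra.
move=> Y AY; rewrite leNgt; apply/negP => XY_lt1.
pose eps := (1 - p (X - Y)) / 4.
have eps_gt0 : 0 < eps by rewrite /eps; lra.
have [s0 s0_gt0 AYs] := AY _ eps_gt0.
have eta_gt0 : 0 < Num.min eps s0 by rewrite lt_min eps_gt0.
have [u [A'u /andP[v_gt0 v_lt] u_far w_X]] := XP _ eta_gt0.
move: v_lt w_X u_far; rewrite lt_min => /andP[_ v_lt].
set th := Num.min _ _; have th_eps : th <= eps by rewrite ge_min lexx.
move=> w_X u_far.
set v := f u - 1%:M in v_gt0 v_lt w_X u_far *.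
have [c Ac c_Y] : exists2 c, A c & p (f c - 1%:M - p v *: Y) <= eps * p v.
  by apply: AYs; rewrite v_gt0.
have split_uc : f u - f c =
    p v *: ((p v)^-1 *: v - X + (X - Y)) - (f c - 1%:M - p v *: Y).
  rewrite addrA subrK [_ *: (_ - Y)]scalerBr scalerA mulfV ?gt_eqF //.
  rewrite scale1r /v.
  by apply/matrixP => i j; rewrite !mxE; ring.
have far_le : (1 - th) * p v <= (eps + (eps + p (X - Y))) * p v.
  apply: le_trans (u_far c Ac) _; rewrite split_uc mulrDl addrC.
  apply: le_trans (pD _ _) _; rewrite pN; apply: lerD c_Y _.
  rewrite pZ gtr0_norm // mulrC ler_wpM2r //.
  apply: le_trans (pD _ _) _; rewrite lerD2r ltW //.
  exact: lt_le_trans th_eps.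
move: far_le th_eps XY_lt1; rewrite ler_pM2r // /eps.
clear split_uc c_Y u_far w_X; move: (th) (p (X - Y)) => t d; lra.
Qed.

End Tangent.

(** * Redundant basis vectors *)

Section Redundancy.
Variables (R : realType) (k : nat) (F : groupType) (f : F -> 'M[R]_k) (B : R).
Hypotheses (fM : forall u v, f (u * v)%g = f u *m f v) (f1 : f 1%g = 1%:M).
Hypothesis fB : forall u, `|f u| <= B.

Local Notation p := (inv_norm f).
Local Notation c := (packing_number (k * k)).

Let pD := inv_normD fB.
Let pZ := inv_normZ f1 fB.
Let p_ge0 := inv_norm_ge0 f1 fB.

Lemma matrix_packing (x : 'I_c -> 'M[R]_k) : (forall i, p (x i) <= 1) ->
  exists i j, i != j /\ p (x i - x j) < 1 / 2.
Proof.
move=> x_le1.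
have [|i [j [ij x_ij]]] :=
    packing (x := mxvec \o x) (inv_norm_coord_norm f1 fB).
  by move=> i /=; rewrite mxvecK.
by exists i, j; split=> //; move: x_ij; rewrite /= linearB /= !mxvecK.
Qed.

(** Among [c] vectors two have normalised versions at distance less than
    [1 / 2]; subtracting the shorter of the two vectors from the longer one
    then gains half of the length of the shorter one. *)
Lemma shorten (x : 'I_c -> 'M[R]_k) eta : 0 < eta ->
  (forall i, eta <= p (x i)) ->
  exists i j, i != j /\ p (x j - x i) <= p (x j) - eta / 2.
Proof.
move=> eta_gt0 x_ge.
have x_gt0 i : 0 < p (x i) := lt_le_trans eta_gt0 (x_ge i).
pose w i := (p (x i))^-1 *: x i.
have [|i [j [ij w_ij]]] := @matrix_packing w.
  by move=> i; rewrite pZ gtr0_norm ?invr_gt0 // mulVf ?gt_eqF.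
have {}w_ij : p (w j - w i) < 1 / 2 /\ p (w i - w j) < 1 / 2.
  by split; [rewrite (inv_normB f1 fB); exact: w_ij | exact: w_ij].
wlog le_ij : i j ij w_ij / p (x i) <= p (x j).
  move=> wl; have [le_ij|/ltW le_ji] := leP (p (x i)) (p (x j)).
    exact: (wl i j).
  case: w_ij => w_ij w_ji; have ji : j != i by rewrite eq_sym.
  exact: (wl j i ji (conj w_ji w_ij) le_ji).
exists i, j; split=> //.
have -> : x j - x i = p (x i) *: (w j - w i) + (1 - p (x i) / p (x j)) *: x j.
  rewrite scalerBr !scalerA mulfV ?gt_eqF // scale1r scalerBl scale1r.
  by rewrite [RHS]addrC addrA subrK.
apply: le_trans (pD _ _) _; rewrite !pZ gtr0_norm // ger0_norm; last first.
  by rewrite subr_ge0 ler_pdivrMr // mul1r.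
rewrite mulrBl mul1r divfK ?gt_eqF //.
have := x_ge i; case: w_ij => + _; have := x_gt0 i; nra.
Qed.

(** Nielsen reduction, for the length [p (f x - 1)]: as long as all the
    vectors of the block [e] have length at least [eta], [shorten] provides a
    Nielsen move inside the block that lowers the total length by [eta / 2],
    because the quotient of two elements has the norm of their difference as
    length. *)
Lemma short_generator (I : eqType) (e : 'I_c -> I) (b : I -> F) eta :
  injective e -> 0 < eta -> is_basis b ->
  exists b', [/\ is_basis b', forall l, ~ range e l -> b' l = b l,
    forall i, gen (range (b \o e)) (b' (e i)) &
    exists i, p (f (b' (e i)) - 1%:M) < eta].
Proof.
move=> einj eta_gt0.
pose total (b : I -> F) := \sum_i p (f (b (e i)) - 1%:M).
have [N b_lt] : exists N, total b < N%:R * (eta / 2).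
  exists (Num.trunc (total b / (eta / 2))).+1.
  by rewrite -ltr_pdivrMr ?truncnS_gt // divr_gt0.
elim: N b b_lt => [|N IHN] b b_lt b_basis.
  by move: b_lt; rewrite mul0r ltNge sumr_ge0.
have [[i b_i]|no_short] := pselect (exists i, p (f (b (e i)) - 1%:M) < eta).
  exists b; split=> // [l|]; last by exists i.
  by apply: gen_in; exists l.
have [i|i [j [ij le_ij]]] := @shorten (fun i => f (b (e i)) - 1%:M) eta eta_gt0.
  by rewrite leNgt; apply/negP => ?; apply: no_short; exists i.
pose b1 := nielsen b (e i) (e j).
have eij : e i != e j by rewrite (inj_eq einj).
have b1_j : b1 (e j) = ((b (e i))^-1 * b (e j))%g by rewrite /b1 /nielsen eqxx.
have b1_l l : l != e j -> b1 l = b l by rewrite /b1 /nielsen => /negPf ->.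
have b1_lt : total b1 < N%:R * (eta / 2).
  move: b_lt; rewrite /total (bigD1 j) //= [X in _ -> X < _](bigD1 j) //=.
  rewrite [in X in _ -> X](eq_bigr (fun l => p (f (b (e l)) - 1%:M)));
    last by move=> l lj; rewrite b1_l // (inj_eq einj).
  rewrite b1_j -(inv_norm_dist fM f1 fB) -natr1.
  move: le_ij; rewrite opprB addrA subrK; lra.
have [b' [b'_basis b'_b1 b'_gen b'_short]] :=
  IHN b1 b1_lt (nielsen_basis eij b_basis).
exists b'; split;
  [exact: b'_basis | move=> l l_out | move=> l | exact: b'_short].
  rewrite (b'_b1 _ l_out) b1_l; first by [].
  by apply/eqP => lj; apply: l_out; exists j; rewrite ?lj.
apply: gen_sub (b'_gen l) => _ [l' _ <-] /=.
have [->|lj] := eqVneq l' j.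
  rewrite b1_j; apply: gen_mul; first apply: gen_inv.
    by apply: gen_in; exists i.
  by apply: gen_in; exists j.
by rewrite b1_l ?(inj_eq einj) //; apply: gen_in; exists l'.
Qed.

(** Cut the basis into [c] blocks of [c] vectors, and let [Gam q] be generated
    by the first [q] blocks. If at some [q] the elements of [Gam q.+1] close
    to the identity adhere to [Gam q], a Nielsen reduction of the block [q]
    produces such an element as a basis vector. Otherwise each [q] yields a
    tangent vector as in [new_tangent], and [c] unit vectors at mutual
    distances at least [1] contradict [packing]. *)
Lemma adherent_basis_vector n (b : 'I_n -> F) : (c * c <= n)%N -> is_basis b ->
  exists (b' : 'I_n -> F) j,
    is_basis b' /\ adherent f (gen (b' @` [set i | i != j])) (b' j).
Proof.
move=> cc_n b_basis.
pose Gam q := gen (b @` [set i : 'I_n | (i < q * c)%N]).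
have Gam_sub q r : (q <= r)%N -> Gam q `<=` Gam r.
  move=> qr; apply: gen_sub => _ [i /= i_lt <-]; apply: gen_in; exists i => //=.
  by apply: leq_trans i_lt _; rewrite leq_mul2r qr orbT.
have [[q [eta eta_gt0 good]]|bad] := pselect (exists q : 'I_c,
    exists2 eta, 0 < eta & forall x, Gam q.+1 x -> p (f x - 1%:M) < eta ->
      adherent f (Gam q) x).
  have e_lt (i : 'I_c) : (q * c + i < n)%N.
    by apply: leq_trans cc_n; have := ltn_ord q; have := ltn_ord i; nia.
  pose e i := Ordinal (e_lt i).
  have einj : injective e by move=> i j [/addnI /val_inj].
  have [b' [b'_basis b'_b b'_gen [i b'_short]]] :=
    short_generator einj eta_gt0 b_basis.
  exists b', (e i); split=> //.
  have b'_Gam : Gam q.+1 (b' (e i)).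
    apply: gen_sub (b'_gen i) => _ [l _ <-]; apply: gen_in; exists (e l) => //=.
    by rewrite mulSn addnC ltn_add2r.
  move=> eps /(good _ b'_Gam b'_short)[x Gx x_near]; exists x => //.
  apply: gen_sub Gx => _ [l /= l_lt <-]; apply: gen_in; exists l => /=.
    by apply: contraTneq l_lt => ->; rewrite /= -leqNgt leq_addr.
  rewrite b'_b // => -[l' _ l_e]; move: l_lt.
  by rewrite -l_e /= ltnNge leq_addr.
exfalso.
have newX (q : 'I_c) : exists X, [/\ p X <= 1, tangent f (Gam q.+1) X &
    forall Y, tangent f (Gam q) Y -> 1 <= p (X - Y)].
  apply: (new_tangent fM f1 fB) => [|||eta eta_gt0]; try exact: gen_subgroup.
    exact: Gam_sub.
  apply: contrapT => none; apply: bad; exists q, eta => // x Gx x_near.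
  by apply: contrapT => x_far; apply: none; exists x.
have [X XP] := choice newX.
have [|i [j [ij X_ij]]] := @matrix_packing X; first by move=> i; case: (XP i).
have apart (a d : 'I_c) : (a < d)%N -> 1 <= p (X d - X a).
  move=> ad; have [_ _ ] := XP d; apply => eps eps_gt0.
  have [_ aT _] := XP a; have [s0 s0_gt0 aTs] := aT _ eps_gt0.
  by exists s0 => // s /aTs[u Gu ?]; exists u => //; apply: Gam_sub Gu.
have [ij_lt|ji_lt|/val_inj ij_eq] := ltngtP i j.
- by have := apart _ _ ij_lt; rewrite (inv_normB f1 fB); lra.
- by have := apart _ _ ji_lt; lra.
- by rewrite ij_eq eqxx in ij.
Qed.

(** The elements adherent to a subgroup form a subgroup, by invariance of the
    norm. *)
Lemma adherent_gen (I : eqType) (b : I -> F) (j : I) w :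
    adherent f (gen (b @` [set i | i != j])) (b j) -> gen (range b) w ->
  forall eps, 0 < eps ->
    exists2 c, gen (b @` [set i | i != j]) c & `|f w - f c| < eps.
Proof.
set A := gen (b @` _) => b_j.
suff adh : gen (range b) `<=` adherent f A.
  move=> /adh w_A eps /w_A[x Ax x_w]; exists x => //.
  exact: le_lt_trans (inv_norm_ge_norm f1 fB _) x_w.
move=> x; elim=> {x w}[_ [i _ <-]||x y _ xA _ yA|x _ xA] eps eps_gt0.
- have [->|ij] := eqVneq i j; first exact: b_j.
  exists (b i); first by apply: gen_in; exists i.
  by rewrite subrr (inv_norm0 f1 fB).
- by exists 1%g; [exact: gen_one | rewrite subrr (inv_norm0 f1 fB)].
- have eps2 : 0 < eps / 2 by lra.
  have [a Aa xa] := xA _ eps2; have [d Ad yd] := yA _ eps2.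
  exists (a * d)%g; first exact: gen_mul.
  have -> : f (x * y)%g - f (a * d)%g = f x *m (f y - f d) + (f x - f a) *m f d.
    by rewrite !fM mulmxBr mulmxBl addrA subrK.
  apply: le_lt_trans (pD _ _) _.
  by rewrite (inv_norm_mull fM f1 fB) (inv_norm_mulr fM f1 fB); lra.
have [a Aa xa] := xA _ eps_gt0; exists a^-1%g; first exact: gen_inv.
have -> : f x^-1%g - f a^-1%g = f x^-1%g *m (f a - f x) *m f a^-1%g.
  rewrite mulmxBr mulmxBl -!fM mulgK.
  by rewrite mulVg mul1g.
rewrite (inv_norm_mulr fM f1 fB) (inv_norm_mull fM f1 fB).
by rewrite (inv_normB f1 fB).
Qed.

End Redundancy.

(** * Complex matrices as real matrices *)

Section Realification.
Variables (R : realType) (m : nat).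

Local Notation Re := (@complex.Re R).
Local Notation Im := (@complex.Im R).

Lemma Re_sum I (r : seq I) (z : I -> R[i]%C) :
  Re (\sum_(i <- r) z i) = \sum_(i <- r) Re (z i).
Proof. by apply: (big_morph Re) => // -[a b] [c d]. Qed.

Lemma Im_sum I (r : seq I) (z : I -> R[i]%C) :
  Im (\sum_(i <- r) z i) = \sum_(i <- r) Im (z i).
Proof. by apply: (big_morph Im) => // -[a b] [c d]. Qed.

Definition realify (x : 'M[Cplx R]_m) : 'M[R]_(m + m) :=
  block_mx (map_mx Re x) (- map_mx Im x) (map_mx Im x) (map_mx Re x).

Lemma realifyM (x y : 'M[Cplx R]_m) : realify (x *m y) = realify x *m realify y.
Proof.
have re : map_mx Re (x *m y) =
    map_mx Re x *m map_mx Re y - map_mx Im x *m map_mx Im y.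
  apply/matrixP => i j; rewrite !mxE Re_sum -sumrB.
  by apply: eq_bigr => l _; rewrite !mxE; case: (x i l) (y l j) => a b [c d].
have im : map_mx Im (x *m y) =
    map_mx Im x *m map_mx Re y + map_mx Re x *m map_mx Im y.
  apply/matrixP => i j; rewrite !mxE Im_sum -big_split /=.
  apply: eq_bigr => l _; rewrite !mxE addrC.
  by case: (x i l) (y l j) => a b [c d].
rewrite /realify mulmx_block re im !(mulNmx, mulmxN) opprD.
congr block_mx.
- by rewrite addrC.
- by rewrite addrC.
Qed.

Lemma realify1 : realify 1%:M = 1%:M.
Proof.
rewrite /realify scalar_mx_block.
have -> : map_mx Re (1%:M : 'M[Cplx R]_m) = 1%:M.
  by apply/matrixP => i j; rewrite !mxE; case: (i == j).
have -> : map_mx Im (1%:M : 'M[Cplx R]_m) = 0.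
  by apply/matrixP => i j; rewrite !mxE; case: (i == j).
by rewrite oppr0.
Qed.

Lemma realify_coord (x : 'M[Cplx R]_m) i j :
  `|Re (x i j)| <= `|realify x| /\ `|Im (x i j)| <= `|realify x|.
Proof.
split.
  have := mx_norm_coord (realify x) (lshift m i) (lshift m j).
  by rewrite block_mxEul mxE.
have := mx_norm_coord (realify x) (rshift m i) (lshift m j).
by rewrite block_mxEdl mxE.
Qed.

Lemma realify_le (x : 'M[Cplx R]_m) c : 0 <= c ->
  (forall i j, `|Re (x i j)| <= c /\ `|Im (x i j)| <= c) -> `|realify x| <= c.
Proof.
move=> c_ge0 xc; apply: mx_norm_le => // i j.
case: (split_ordP i) => i' ->; case: (split_ordP j) => j' ->;
  rewrite ?(block_mxEul, block_mxEur, block_mxEdl, block_mxEdr) !mxE ?normrN;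
  by case: (xc i' j').
Qed.

Lemma realifyB (x y : 'M[Cplx R]_m) : realify (x - y) = realify x - realify y.
Proof.
have re : map_mx Re (x - y) = map_mx Re x - map_mx Re y.
  by apply/matrixP => i j; rewrite !mxE; case: (x i j) (y i j) => a b [c d].
have im : map_mx Im (x - y) = map_mx Im x - map_mx Im y.
  by apply/matrixP => i j; rewrite !mxE; case: (x i j) (y i j) => a b [c d].
rewrite /realify re im opp_block_mx add_block_mx !opprB !opprK.
by rewrite (addrC (map_mx Im y)).
Qed.

Lemma norm_ltc (z : Cplx R) (e : R) : `|Re z| < e / 2 -> `|Im z| < e / 2 ->
  `|z| < (e%:C)%C.
Proof.
case: z => a b /= ae be; rewrite -[`|_|]/(`|(a +i* b)%C : R[i]%C|).
rewrite normc_def ltcR /=.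
apply: (@le_lt_trans _ _ (`|a| + `|b|)); last by lra.
rewrite -(ger0_norm (addr_ge0 (normr_ge0 a) (normr_ge0 b))) -sqrtr_sqr.
rewrite ler_sqrt ?sqr_ge0 //.
rewrite -(real_normK (num_real a)) -(real_normK (num_real b)).
by have := normr_ge0 a; have := normr_ge0 b; nra.
Qed.

(** The norm of a complex number is at most the sum of the norms of its real and
    imaginary parts, so approximation of the real matrices gives approximation
    in the topology of [GL]. *)
Lemma closure_realify (S : set (GL R m)) (x : GL R m) :
  (forall eps, 0 < eps -> exists2 c, S c & `|realify x - realify c| < eps) ->
  closure S x.
Proof.
move=> x_near V [_ [[A A_open <-] Ax AV]].
have /nbhs_ballP [e /= e_gt0 eA] : nbhs (GL_mx x) A by apply: open_nbhs_nbhs.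
move: (e_gt0); rewrite ltcE => /andP[/eqP /= e_im e_re].
have [c Sc xc] := x_near _ (divr_gt0 e_re (ltr0n _ 2)).
exists c; split => //; apply: AV; apply: eA; split=> // i j.
rewrite /ball /=.
have -> : e = ((Re e)%:C)%C by case: (e) e_im => a b /= ->.
move: xc; rewrite -realifyB => xc.
have [] := realify_coord (GL_mx x - GL_mx c) i j; rewrite !mxE => xr xi.
by apply: norm_ltc; apply: le_lt_trans xc.
Qed.

Lemma realify_near (x : 'M[Cplx R]_m) eps : 0 < eps ->
  nbhs x [set y | `|realify x - realify y| <= eps].
Proof.
move=> eps_gt0; have epsC_gt0 : 0 < (eps%:C)%C :> Cplx R by rewrite ltcR.
apply: (filterS _ (nbhsx_ballx x _ epsC_gt0)) => y [_ xy] /=.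
rewrite -realifyB; apply: realify_le (ltW eps_gt0) _ => i j.
have := xy i j; rewrite /ball /= => /ltW xy_ij; rewrite !mxE.
split; rewrite -lecR.
  exact: le_trans (normc_ge_Re _) xy_ij.
have -> : Im (x i j - y i j) = - Re ((x i j - y i j) * 'i%C).
  by rewrite ReiNIm opprK.
rewrite normrN; apply: le_trans (normc_ge_Re _) _.
by rewrite normrM [`|(_ *i)%C|]normc_def /= expr0n expr1n add0r sqrtr1 mulr1.
Qed.

Lemma realify_continuous : continuous realify.
Proof.
move=> x; apply: (iffRL (@cvgrPdist_le _ _ _ (nbhs x) _ _ _)) => eps.
exact: realify_near.
Qed.

Lemma compact_realify_bounded (G : set (GL R m)) : compact G ->
  exists B, forall x, G x -> `|realify x| <= B.
Proof.
move=> G_compact.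
have cont : continuous (realify \o @GL_mx R m).
  move=> x; apply: continuous_comp; last exact: realify_continuous.
  exact: initial_continuous.
have /compact_bounded [M [_ MG]] :
    compact ((realify \o @GL_mx R m) @` G).
  by apply: continuous_compact => //; apply: continuous_subspaceT.
by exists (M + 1) => x Gx; apply: (MG (M + 1)); [lra | exists x].
Qed.

End Realification.

Theorem theorem2 (R : realType) (m : nat) (hm : (1 <= m)%N) :
  exists2 N : nat, (1 <= N)%N &
    forall n : nat, (N <= n)%N ->
    forall G : set (GL R m), is_subgroup G -> compact G ->
    forall rho : {multiplicative 'Free_n -> GL R m},
      (forall w, G (rho w)) -> redundant G rho.
Proof.
pose c := packing_number ((m + m) * (m + m)).
(* Two more than [c * c], so that the complementary factor has positive rank. *)
exists (c * c).+2 => // -[//|[//|n]] n_ge G _ G_compact rho rhoG.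
have [B GB] := compact_realify_bounded G_compact.
pose f w := realify (rho w).
have fM u v : f (u * v)%g = f u *m f v by rewrite /f gmulfM -realifyM.
have f1 : f 1%g = 1%:M by rewrite /f hom1 realify1.
have fB w : `|f w| <= B by apply: GB.
have [b [j [b_basis b_j]]] : exists (b : 'I_n.+2 -> 'Free_n.+2) j,
    is_basis b /\ adherent f (gen (b @` [set i | i != j])) (b j).
  apply: (adherent_basis_vector fM f1 fB) (fg_gen_basis _).
  exact: leq_trans (leqW (leqnSn _)) n_ge.
set A := gen (b @` [set i | i != j]) in b_j.
have rank_A : gen (range (b \o lift j)) = A.
  congr gen; apply/seteqP; split=> _ [i + <-].
    by move=> _; exists (lift j i) => //=; rewrite eq_sym neq_lift.
  by rewrite /= eq_sym => /unlift_some[i' -> _]; exists i'.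
have rank_B : gen (range (b \o fun _ : 'I_1 => j)) = gen [set b j].
  by congr gen; apply/seteqP; split=> [_ [_ _ <-]|_ ->] //; exists ord0.
exists A, (gen [set b j]); split.
- exact: basis_free_product b_basis.
- by exists n.+1 => //; rewrite -rank_A; apply: basis_free_of_rank lift_inj.
- exists 1%N => //; rewrite -rank_B; apply: basis_free_of_rank => // i i' _.
  by rewrite !ord1.
have dense : range rho `<=` closure (rho @` A).
  move=> _ [w _ <-]; apply: closure_realify => eps eps_gt0.
  have [b_gen _] := b_basis.
  have [w' Aw' w_w'] := adherent_gen fM f1 fB b_j (b_gen w) eps_gt0.
  by exists (rho w'); [exists w' | exact: w_w'].
apply/seteqP; split=> x [Gx x_cl]; split=> //.
  by move: x_cl; apply: closureS => _ [w _ <-]; exists w.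
have /closure_id -> := @closed_closure _ (rho @` A).
exact: (closureS dense).
Qed.
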